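(* Let $A_1,A_2\in\mathbf{C}^{n\times n}$, $B_1,B_2\in\mathbf{C}^{n\times m}$, and consider the system equation $$x^+=A_1x+A_2^{\#}x^{\#}+B_1u+B_2^{\#}u^{\#},\qquad x(0)=x_0,$$ where $x^+(t)=\dot x(t)$ for $t\in\mathbf{R}^+=[0,\infty)$ (continuous time) and $x^+(t)=x(t+1)$ for $t\in\mathbf{Z}^+=\{0,1,2,\dots\}$ (discrete time). For any $x_0\in\mathbf{C}^n$ and any input $u(t)\in\mathbf{C}^m$ (locally integrable in the continuous-time case), this equation has the unique solution $$x(t)=\mathrm{e}^{t\{A_1,A_2\}}x_0+\int_0^t\mathrm{e}^{(t-s)\{A_1,A_2\}}\{B_1,B_2\}u(s)\,\mathrm{d}s,\quad t\in\mathbf{R}^+,$$ $$x(t)=\{A_1,A_2\}^tx_0+\sum_{i=0}^{t-1}\{A_1,A_2\}^{t-1-i}\{B_1,B_2\}u(i),\quad 1\le t\in\mathbf{Z}^+,$$ and equivalently $$x(t)=\{\Phi_1(t),\Phi_2(t)\}x_0+\int_0^t\{\Phi_1(t-s),\Phi_2(t-s)\}\{B_1,B_2\}u(s)\,\mathrm{d}s,\quad t\in\mathbf{R}^+,$$ $$x(t)=\{\Phi_1(t),\Phi_2(t)\}x_0+\sum_{i=0}^{t-1}\{\Phi_1(t-1-i),\Phi_2(t-1-i)\}\{B_1,B_2\}u(i),\quad 1\le t\in\mathbf{Z}^+,$$ where $\begin{bmatrix}\Phi_1(t)\\ \Phi_2(t)\end{bmatrix}=\mathrm{e}^{t\{A_1,A_2\}_\diamond}\begin{bmatrix}I_n\\0\end{bmatrix}$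 for $t\in\mathbf{R}^+$ and $=\left(\{A_1,A_2\}_\diamond\right)^t\begin{bmatrix}I_n\\0\end{bmatrix}$ for $t\in\mathbf{Z}^+$.
   Context: $P^{\#}$ denotes entrywise conjugate. For matrices $A_1,A_2$ of equal size, the bimatrix $\{A_1,A_2\}$ is the real-linear map $x\mapsto A_1x+A_2^{\#}x^{\#}$; products of bimatrices are compositions. Powers: $\{A_1,A_2\}^0=\{I_n,0\}$ (identity), $\{A_1,A_2\}^i=\{A_1,A_2\}\{A_1,A_2\}^{i-1}$. Exponent: $\mathrm{e}^{t\{A_1,A_2\}}=\sum_{i=0}^\infty\frac{t^i}{i!}\{A_1,A_2\}^i$ (applied pointwise to vectors). Complex lifting: $\{A_1,A_2\}_\diamond=\begin{bmatrix}A_1 & A_2^{\#}\\ A_2 & A_1^{\#}\end{bmatrix}$. *)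

(* Defs.v *)
From HB Require Import structures.
From mathcomp Require Import all_boot all_order all_algebra.
From mathcomp Require Import complex.
From mathcomp Require Import all_classical all_reals all_analysis.
Set Implicit Arguments. Unset Strict Implicit. Unset Printing Implicit Defensive.
Import Order.TTheory GRing.Theory Num.Theory.
Import numFieldNormedType.Exports.
Local Open Scope ring_scope.
Local Open Scope complex_scope.
Local Open Scope classical_set_scope.

(* The usual (norm) topology on R[i]: copied from the regular structure
   R[i]^o, as mathcomp-analysis does for numFieldTypes.  Matrices over R[i]
   then get the usual product (entrywise) topology. *)
HB.instance Definition _ (R : rcfType) := PseudoPointedMetric.copy R[i] R[i]^o.
HB.instance Definition _ (R : rcfType) := NormedModule.copy R[i] R[i]^o.

Section Bimatrix.
Context {R : realType}.

Definition conjmx {p q : nat} (P : 'M[R[i]]_(p, q)) : 'M[R[i]]_(p, q) :=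
  map_mx (@conjc R) P.

Definition bimx {p q : nat} (A1 A2 : 'M[R[i]]_(p, q)) (x : 'cV[R[i]]_q)
  : 'cV[R[i]]_p := A1 *m x + conjmx A2 *m conjmx x.

Definition bipow {n : nat} (A1 A2 : 'M[R[i]]_n) (i : nat) : 'cV[R[i]]_n -> 'cV[R[i]]_n :=
  iter i (bimx A1 A2).

Definition biexp {n : nat} (t : R) (A1 A2 : 'M[R[i]]_n) (x : 'cV[R[i]]_n)
  : 'cV[R[i]]_n :=
  lim (series (fun i : nat => (t ^+ i / (i`!)%:R)%:C *: bipow A1 A2 i x) @ \oo).

Definition mexp {k : nat} (t : R) (M : 'M[R[i]]_k) : 'M[R[i]]_k :=
  lim (series (fun i : nat => (t ^+ i / (i`!)%:R)%:C *: M ^+ i) @ \oo).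

Definition bilift {n : nat} (A1 A2 : 'M[R[i]]_n) : 'M[R[i]]_(n + n) :=
  block_mx A1 (conjmx A2) A2 (conjmx A1).

Definition PhiC {n : nat} (A1 A2 : 'M[R[i]]_n) (t : R) : 'M[R[i]]_(n + n, n) :=
  mexp t (bilift A1 A2) *m col_mx 1%:M 0.
Definition Phi1C {n : nat} (A1 A2 : 'M[R[i]]_n) (t : R) : 'M[R[i]]_n :=
  usubmx (PhiC A1 A2 t).
Definition Phi2C {n : nat} (A1 A2 : 'M[R[i]]_n) (t : R) : 'M[R[i]]_n :=
  dsubmx (PhiC A1 A2 t).

Definition PhiD {n : nat} (A1 A2 : 'M[R[i]]_n) (t : nat) : 'M[R[i]]_(n + n, n) :=
  (bilift A1 A2) ^+ t *m col_mx 1%:M 0.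
Definition Phi1D {n : nat} (A1 A2 : 'M[R[i]]_n) (t : nat) : 'M[R[i]]_n :=
  usubmx (PhiD A1 A2 t).
Definition Phi2D {n : nat} (A1 A2 : 'M[R[i]]_n) (t : nat) : 'M[R[i]]_n :=
  dsubmx (PhiD A1 A2 t).

Definition cintegrable {p : nat} (D : set R) (f : R -> 'cV[R[i]]_p) : Prop :=
  forall j : 'I_p,
    (@lebesgue_measure R).-integrable D (fun s => (@complex.Re R (f s j 0))%:E) /\
    (@lebesgue_measure R).-integrable D (fun s => (@complex.Im R (f s j 0))%:E).

Definition locint {p : nat} (f : R -> 'cV[R[i]]_p) : Prop :=
  forall t : R, 0 <= t -> cintegrable `[0, t] f.

Definition cint {p : nat} (t : R) (f : R -> 'cV[R[i]]_p) : 'cV[R[i]]_p :=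
  \col_j ((Rintegral (@lebesgue_measure R) `[0, t] (fun s => @complex.Re R (f s j 0)))
          +i* (Rintegral (@lebesgue_measure R) `[0, t] (fun s => @complex.Im R (f s j 0)))).

(* continuous-time solution on R^+ (Caratheodory sense, as required for
   locally integrable inputs): the right-hand side
   s |-> A1 x + A2^# x^# + B1 u + B2^# u^# is locally integrable and
   x(t) = x0 + \int_0^t (right-hand side)(s) ds for all t >= 0. *)
Definition csol {n m : nat} (A1 A2 : 'M[R[i]]_n) (B1 B2 : 'M[R[i]]_(n, m))
  (x0 : 'cV[R[i]]_n) (u : R -> 'cV[R[i]]_m) (x : R -> 'cV[R[i]]_n) : Prop :=
  let rhs := fun s => bimx A1 A2 (x s) + bimx B1 B2 (u s) in
  locint rhs /\ forall t : R, 0 <= t -> x t = x0 + cint t rhs.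

Definition dsol {n m : nat} (A1 A2 : 'M[R[i]]_n) (B1 B2 : 'M[R[i]]_(n, m))
  (x0 : 'cV[R[i]]_n) (u : nat -> 'cV[R[i]]_m) (x : nat -> 'cV[R[i]]_n) : Prop :=
  x 0%N = x0 /\ forall t : nat, x t.+1 = bimx A1 A2 (x t) + bimx B1 B2 (u t).

End Bimatrix.

(* Main.v *)
(* In real coordinates on C^n = R^2n the real-linear map {A1, A2} is a matrix M.
   The variation-of-constants formula for the Caratheodory problem
   x = x0 + int_0 (M x + g), with g only locally integrable, rests on the product
   rule for F(t) (c + int_0^t h) with F of class C^1 and h in L^1_loc: applied to
   e^{tM} and h(s) = e^{-sM} g(s) it gives existence, applied to e^{-tM} and
   h = M x + g it gives e^{-tM} x(t) = x0 + int_0^t e^{-sM} g(s) ds, i.e. uniqueness.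
   The formulas with Phi hold because P |-> {P_11, P_21} is real-linear and
   continuous on 2n x 2n matrices and sends the k-th power of the lifting to
   {A1, A2}^k, hence one exponential series to the other. *)
Require Import Defs.
From HB Require Import structures.
From mathcomp Require Import all_boot all_order all_algebra.
From mathcomp Require Import complex.
From mathcomp Require Import all_classical all_reals all_analysis.
From mathcomp Require Import ring.
Import Order.TTheory GRing.Theory Num.Theory.
Import numFieldNormedType.Exports.
Local Open Scope ring_scope.
Local Open Scope complex_scope.
Local Open Scope classical_set_scope.

Set Implicit Arguments. Unset Strict Implicit. Unset Printing Implicit Defensive.

(** * Locally integrable functions and a product rule *)

Section LocallyIntegrable.
Context {R : realType}.
Notation mu := (@lebesgue_measure R).
Implicit Types f g h F : R -> R.

Definition loc_integrable f : Prop :=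
  forall t : R, 0 <= t -> mu.-integrable `[0, t] (EFin \o f).

Definition int0 f (t : R) : R := \int[mu]_(s in `[0, t]) f s.

Lemma eq_int0 f g (t : R) : (forall s, 0 <= s <= t -> f s = g s) ->
  int0 f t = int0 g t.
Proof. by move=> fg; apply: eq_Rintegral => s; rewrite inE/= in_itv/= => /fg. Qed.

Lemma eq_loc_integrable f g : (forall s, 0 <= s -> f s = g s) ->
  loc_integrable f -> loc_integrable g.
Proof.
move=> fg fi t t0; apply: eq_integrable (fi t t0) => //= s.
by rewrite inE/= in_itv/= => /andP[/fg <-].
Qed.

Lemma int00 f : int0 f 0 = 0.
Proof. by rewrite /int0 set_itv1 Rintegral_set1. Qed.

Lemma loc_integrableD f g : loc_integrable f -> loc_integrable g ->
  loc_integrable (fun s => f s + g s).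
Proof. by move=> fi gi t t0; apply: (integrableD _ (fi t t0) (gi t t0)). Qed.

Lemma int0D f g t : 0 <= t -> loc_integrable f -> loc_integrable g ->
  int0 (fun s => f s + g s) t = int0 f t + int0 g t.
Proof. by move=> t0 fi gi; apply: RintegralD => //; [exact: fi|exact: gi]. Qed.

Lemma loc_integrable0 : loc_integrable (fun=> 0).
Proof. by move=> t t0; exact: integrable0. Qed.

Lemma loc_integrable_sum (I : Type) (r : seq I) (f : I -> R -> R) :
  (forall i, loc_integrable (f i)) ->
  loc_integrable (fun s => \sum_(i <- r) f i s).
Proof.
move=> fi; elim: r => [|i r IH].
  by under [X in loc_integrable X]eq_fun do rewrite big_nil; exact: loc_integrable0.
under [X in loc_integrable X]eq_fun do rewrite big_cons.
exact: loc_integrableD.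
Qed.

Lemma int0_sum (I : Type) (r : seq I) (f : I -> R -> R) t : 0 <= t ->
  (forall i, loc_integrable (f i)) ->
  int0 (fun s => \sum_(i <- r) f i s) t = \sum_(i <- r) int0 (f i) t.
Proof.
move=> t0 fi; elim: r => [|i r IH].
  rewrite big_nil -[RHS](mulr0 (fine (mu `[0%R, t]))) mulrC -Rintegral_cst//.
  by apply: eq_int0 => s _; rewrite big_nil.
rewrite big_cons -IH -int0D//; last exact: loc_integrable_sum.
by apply: eq_int0 => s _; rewrite big_cons.
Qed.

Lemma continuous_segment_bound F (t : R) : continuous F ->
  exists2 C, 0 <= C & forall s, 0 <= s <= t -> `|F s| <= C.
Proof.
move=> cF; have [t0|t0] := leP 0 t; last first.
  exists 0 => // s /andP[s0 st]; have := le_lt_trans (le_trans s0 st) t0.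
  by rewrite ltxx.
have cn : {within `[0, t], continuous (fun s => `|F s|)}.
  apply: continuous_subspaceT => s.
  by apply: (@continuous_comp _ _ _ F Num.norm); [exact: cF|exact: norm_continuous].
have [c _ H] := EVT_max t0 cn.
by exists `|F c| => // s st; apply: H; rewrite in_itv.
Qed.

(** A continuous factor is bounded on each segment [0, t], and a bounded measurable factor preserves
    integrability. *)
Lemma loc_integrableM F h : continuous F -> loc_integrable h ->
  loc_integrable (fun s => F s * h s).
Proof.
move=> cF hi t t0; have [C C0 FC] := continuous_segment_bound t cF.
apply: (@integrableMr _ _ _ mu `[0, t] _ F (EFin \o h)) => //; last exact: hi.
  by apply: measurable_funTS; exact: measurable_realfun.continuous_measurable_fun.
exists C; split; first exact: num_real.
move=> x Cx s /=; rewrite in_itv/= => st.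
exact: le_trans (FC _ st) (ltW Cx).
Qed.

Lemma continuous_loc_integrable F : continuous F -> loc_integrable F.
Proof.
move=> cF t t0; apply: continuous_compact_integrable; first exact: segment_compact.
exact: continuous_subspaceT.
Qed.

Lemma int0Zl c h t : 0 <= t -> loc_integrable h ->
  int0 (fun s => c * h s) t = c * int0 h t.
Proof. by move=> t0 hi; apply: RintegralZl => //; exact: hi. Qed.

Lemma int0B_itv h (a b : R) : 0 <= a -> a <= b -> loc_integrable h ->
  int0 h b - int0 h a = \int[mu]_(s in `]a, b]) h s.
Proof.
move=> a0 ab hi; rewrite /int0 Rintegral_itvB// ?bnd_simp//.
by apply: hi; apply: le_trans ab.
Qed.

(* Summed over n equal steps the increments are at most
   C * (T / n) * (G T - G 0), which tends to 0. *)
Lemma quadratic_increments_cst (D G : R -> R) (C T : R) : 0 <= T ->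
  (forall a b, 0 <= a -> a <= b -> b <= T ->
     `|D b - D a| <= C * (b - a) * (G b - G a)) ->
  D T = D 0.
Proof.
move=> T0 H; pose p (N k : nat) := T * k%:R / N.+1%:R.
have key N : `|D T - D 0| <= C * (T / N.+1%:R) * (G T - G 0).
  have pT : p N N.+1 = T by rewrite /p mulfK.
  have p0 : p N 0%N = 0 by rewrite /p mulr0 mul0r.
  rewrite -pT -p0 -(telescope_sumr (fun k => D (p N k))) //.
  rewrite -(telescope_sumr (fun k => G (p N k))) // mulr_sumr.
  apply: (le_trans (ler_norm_sum _ _ _)); rewrite pT !big_mkord; apply: ler_sum => k _.
  have -> : T / N.+1%:R = p N k.+1 - p N k.
    by rewrite /p -mulrBl -mulrBr -[k.+1]addn1 natrD addrAC subrr add0r mulr1.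
  apply: H.
  - by rewrite /p divr_ge0// mulr_ge0.
  - by rewrite /p ler_pM2r ?invr_gt0// ler_wpM2l// ler_nat.
  - rewrite /p ler_pdivrMr// ler_wpM2l// ler_nat; exact: ltn_ord.
apply/eqP; rewrite -subr_eq0 -normr_le0; apply/ler_addgt0Pl => e e0.
rewrite addr0; set K := C * T * (G T - G 0).
(* [N.+1] exceeds |K| / e, which makes |K| / (N + 1) smaller than e. *)
pose N := Num.truncn (`|K| / e).
have := key N; move/le_trans; apply.
have -> : C * (T / N.+1%:R) * (G T - G 0) = K / N.+1%:R.
  by rewrite /K mulrA -!mulrA [_^-1 * _]mulrC !mulrA.
rewrite ler_pdivrMr//; apply: le_trans (ler_norm _) _.
rewrite mulrC -ler_pdivrMr//.
by apply/ltW/truncnS_gt.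
Qed.

Lemma is_derive_continuous F f : (forall x : R, is_derive x 1 F (f x)) -> continuous F.
Proof.
move=> dF x; apply: differentiable_continuous; apply/derivable1_diffP.
by case: (dF x).
Qed.

(* [H] is not C^1, so the FTC does not apply to [F * H]; instead the defect of the
   identity has increments over [a, b] bounded by a multiple of
   (b - a) * int_a^b |h|. *)
Lemma int0_product_rule F f h (c : R) :
    (forall x : R, is_derive x 1 F (f x)) -> continuous f -> loc_integrable h ->
  let H t := c + int0 h t in
  loc_integrable (fun s => f s * H s + F s * h s) /\
  forall t, 0 <= t -> int0 (fun s => f s * H s + F s * h s) t = F t * H t - F 0 * c.
Proof.
move=> dF cf hi H.
have cF : continuous F := is_derive_continuous dF.
(* An indefinite integral is continuous on [0, t], hence so is [f * H]. *)
have fHi : loc_integrable (fun s => f s * H s).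
  move=> t t0; apply: continuous_compact_integrable; first exact: segment_compact.
  have cI : {within `[0, t], continuous (fun s => int0 h s)}.
    exact: (parameterized_integral_continuous t0 (hi t t0)).
  move=> s; apply: cvgM; first by apply: (continuous_subspaceT cf).
  by apply: cvgD; [exact: cvg_cst|exact: cI].
have ri : loc_integrable (fun s => f s * H s + F s * h s).
  by apply: loc_integrableD => //; exact: loc_integrableM.
split => // T T0.
have nhi : loc_integrable (fun s => `|h s|).
  by move=> t t0; exact: (integrable_norm (hi t t0)).
have [C C0 fC] := continuous_segment_bound T cf.
pose D t := int0 (fun s => f s * H s + F s * h s) t - F t * H t.
suff : D T = D 0.
  by rewrite /D int00 /H int00 addr0 add0r => /eqP; rewrite subr_eq addrC => /eqP.
(* In [C + C], one [C] bounds the factor [f] of H s - H a, the other bounds the slope of [F] in F s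
   - F b. *)
apply: (@quadratic_increments_cst D (int0 (fun s => `|h s|)) (C + C)) => // a b a0 ab bT.
have b0 : 0 <= b by apply: le_trans ab.
have sub : `]a, b]%classic `<=` `[0, b]%classic.
  by move=> s /=; rewrite !in_itv/= => /andP[as_ ->]; rewrite (le_trans a0 (ltW as_)).
have iS g : loc_integrable g -> mu.-integrable `]a, b] (EFin \o g).
  by move=> gi; apply: (@integrableS _ _ _ mu `[0, b]%classic) (gi b b0).
have Zi k g : loc_integrable g -> mu.-integrable `]a, b] (EFin \o (fun s => k * g s)).
  by move=> gi; apply: (@integrableZl _ _ _ mu _ _ k (EFin \o g)) => //; exact: iS.
rewrite int0B_itv//; set K := \int[mu]_(s in _) _.
have K0 : 0 <= K by apply: Rintegral_ge0.
have absK (s : R) : a < s -> s <= b -> `|int0 h s - int0 h a| <= K.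
  move=> as_ sb; have s0 : 0 <= s by apply: le_trans (ltW as_).
  have sas : `]a, s]%classic `<=` `]a, b]%classic.
    by move=> x /=; rewrite !in_itv/= => /andP[-> /le_trans]; exact.
  rewrite int0B_itv//; last exact: ltW.
  apply: le_trans (le_normr_Rintegral _ _) _ => //.
    apply: (@integrableS _ _ _ mu `]a, b]%classic) (iS _ hi) => //.
  rewrite -subr_ge0 /K -!int0B_itv//; last exact: ltW.
  by rewrite opprB addrA subrK int0B_itv//; apply: Rintegral_ge0.
(* For a = b both sides vanish; the fundamental theorem and the length of ]a, b] are used below with
   a < b. *)
move: (ab); rewrite le_eqVlt => /predU1P[<-|ltab].
  by rewrite !subrr normr0 mulr0 mul0r.
have fi := continuous_loc_integrable cf.
have FTC : F b - F a = \int[mu]_(s in `]a, b]) f s.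
  rewrite Rintegral_itv_obnd_cbnd; last exact: iS.
  rewrite /Rintegral (@continuous_FTC2 _ f F)//; first exact: continuous_subspaceT.
    split; first by move=> x _; case: (dF x).
      exact: cvg_at_right_filter (cF _).
    exact: cvg_at_left_filter (cF _).
  by move=> x _; rewrite derive1E; case: (dF x).
(* Since F b H b - F a H a = F b (H b - H a) + H a (F b - F a), the boundary terms can be moved
   under the integral, where only the differences H s - H a and F s - F b remain. *)
have -> : D b - D a = \int[mu]_(s in `]a, b])
    (f s * (int0 h s - int0 h a) + (F s - F b) * h s).
  have -> : D b - D a = \int[mu]_(s in `]a, b]) (f s * H s + F s * h s)
      - (F b * \int[mu]_(s in `]a, b]) h s + H a * \int[mu]_(s in `]a, b]) f s).
    by rewrite -FTC -!int0B_itv// /D /H; ring.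
  rewrite -!RintegralZl//; [|exact: iS..].
  rewrite -RintegralD//; [|exact: Zi..].
  rewrite -RintegralB//; last 2 first.
    exact: iS.
    by apply: (@integrableD _ _ _ mu _ _ (EFin \o _) (EFin \o _)) => //; exact: Zi.
  by apply: eq_Rintegral => s _; rewrite /H; ring.
have qi : mu.-integrable `]a, b]
    (EFin \o (fun s => f s * (int0 h s - int0 h a) + (F s - F b) * h s)).
  apply: eq_integrable (_ : mu.-integrable _ (EFin \o (fun s =>
    (f s * H s + F s * h s) - (F b * h s + H a * f s)))) => //.
    by move=> s _ /=; congr (_%:E); rewrite /H; ring.
  apply: (@integrableB _ _ _ mu _ _ (EFin \o _) (EFin \o _)) => //; first exact: iS.
  by apply: (@integrableD _ _ _ mu _ _ (EFin \o _) (EFin \o _)) => //; exact: Zi.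
apply: le_trans (le_normr_Rintegral _ _) _ => //.
(* Each of the two summands integrates to C (b - a) K. *)
have -> : (C + C) * (b - a) * K =
    \int[mu]_(s in `]a, b]) (C * K + C * (b - a) * `|h s|).
  rewrite RintegralD//; last 2 first.
    by apply: (iS (fun=> C * K)); apply: continuous_loc_integrable => ?; exact: cvg_cst.
    exact: (Zi (C * (b - a)) (fun s => `|h s|)).
  rewrite Rintegral_cst// RintegralZl//; last exact: (iS _ nhi).
  rewrite /= lebesgue_measure_itv/= lte_fin ltab -/K.
  by rewrite -EFinB/=; ring.
apply: le_Rintegral => //.
- exact: integrable_norm qi.
- by apply: (iS (fun s => C * K + C * (b - a) * `|h s|)); apply: loc_integrableD;
    [apply: continuous_loc_integrable => ?; exact: cvg_cst|];
    apply: (@loc_integrableM (fun=> C * (b - a)) (fun s => `|h s|)) => //; move=> ?; exact: cvg_cst.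
move=> s /=; rewrite in_itv/= => /andP[as_ sb].
have s0 : 0 <= s by apply: le_trans (ltW as_).
apply: le_trans (ler_normD _ _) _; rewrite !normrM lerD//.
  by rewrite ler_pM// ?absK// fC// s0 (le_trans sb).
rewrite ler_wpM2r//.
(* Mean value theorem on [s, b]: |F s - F b| <= C (b - s) <= C (b - a). *)
have [x] := @MVT_segment _ F f s b sb (fun x _ => dF x) (continuous_subspaceT cF).
rewrite in_itv/= => /andP[sx xb] FE.
rewrite distrC FE normrM ler_pM//.
  by rewrite fC// (le_trans s0 sx) (le_trans xb).
by rewrite ger0_norm ?subr_ge0// lerD2l lerN2 ltW.
Qed.

End LocallyIntegrable.

(** * The exponential of a real matrix *)

Lemma cvg_sumr (R : realType) (T I : Type) (F : set_system T) (FF : Filter F)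
    (r : seq I) (u : I -> T -> R) (l : I -> R) :
  (forall i, u i @ F --> l i) ->
  (fun n => \sum_(i <- r) u i n) @ F --> \sum_(i <- r) l i.
Proof.
move=> ul; elim: r => [|i r IH].
  by rewrite big_nil; under eq_fun do rewrite big_nil; exact: cvg_cst.
by rewrite big_cons; under eq_fun do rewrite big_cons; exact: cvgD.
Qed.

Section RealMatrixExponential.
Context {R : realType} {N : nat}.
Implicit Types (M : 'M[R]_N) (i j : 'I_N) (s t : R).

(** Each entry of e^{tM} is treated as a scalar power series in t, so that termwise differentiation
    is available through [pseries]. *)
Definition expmx_coef M i j (k : nat) : R := (M ^+ k) i j / k`!%:R.

Definition rexp t M : 'M[R]_N :=
  \matrix_(i, j) limn (pseries (expmx_coef M i j) t).

(** The sum of the absolute values of all entries dominates every row sum, so each further factor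
    [M] costs at most one factor of it. *)
Lemma expmx_norm_bound M k i j :
  `|(M ^+ k) i j| <= (\sum_a \sum_b `|M a b|) ^+ k.
Proof.
set K := \sum_a _; have K0 : 0 <= K by do 2 (apply: sumr_ge0 => ? _).
elim: k i j => [|k IH] i j.
  by rewrite !expr0 mxE; case: (i == j); rewrite ?normr1 ?normr0.
rewrite !exprS mxE; apply: le_trans (ler_norm_sum _ _ _) _.
apply: (@le_trans _ _ (\sum_l `|M i l| * K ^+ k)).
  by apply: ler_sum => l _; rewrite normrM ler_wpM2l.
rewrite -mulr_suml ler_wpM2r ?exprn_ge0// /K [leRHS](bigD1 i)//= lerDl.
by do 2 (apply: sumr_ge0 => ? _).
Qed.

Lemma is_cvg_expmx M i j t : cvgn (pseries (expmx_coef M i j) t).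
Proof.
set K := \sum_a \sum_b `|M a b|.
apply: normed_cvg.
(* The entry bound K^k makes the series of e^{K|t|} a majorant. *)
apply: (@series_le_cvg _ _ (exp_coeff (K * `|t|))).
- by move=> k; exact: normr_ge0.
- move=> k; rewrite /exp_coeff /= divr_ge0// exprn_ge0// mulr_ge0//.
  by do 2 (apply: sumr_ge0 => ? _).
- move=> k; rewrite /exp_coeff /expmx_coef /= !normrM normfV normr_nat normrX.
  rewrite exprMn mulrAC ler_wpM2r ?invr_ge0// ler_wpM2r ?exprn_ge0//.
  exact: expmx_norm_bound.
- exact: is_cvg_series_exp_coeff.
Qed.

Lemma expmx_coef_diffs M i j k :
  pseries_diffs (expmx_coef M i j) k = (M ^+ k.+1) i j / k`!%:R.
Proof.
by rewrite /pseries_diffs /expmx_coef factS natrM invfM mulrCA mulVKf.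
Qed.

(** Finite sums commute with limits. For [A] equal to [M] and M^2 these are the first and second
    termwise derivatives of the entries of e^{tM}. *)
Lemma cvg_expmx_mull (A : 'M[R]_N) M i j t :
  pseries (fun k => (A *m M ^+ k) i j / k`!%:R) t @ \oo --> (A *m rexp t M) i j.
Proof.
rewrite mxE.
have -> : pseries (fun k => (A *m M ^+ k) i j / k`!%:R) t =
    (fun n => \sum_l A i l * pseries (expmx_coef M l j) t n).
  apply/funext => n; rewrite /pseries /series /=.
  under [RHS]eq_bigr do rewrite mulr_sumr.
  rewrite exchange_big/=; apply: eq_bigr => k _.
  rewrite mxE !mulr_suml; apply: eq_bigr => l _.
  by rewrite /expmx_coef !mulrA.
apply: cvg_sumr => l; rewrite mxE; apply: cvgMl_tmp; exact: is_cvg_expmx.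
Qed.

Lemma cvg_expmx_mulr q (A : 'M[R]_(N, q)) M i (j : 'I_q) t :
  pseries (fun k => (M ^+ k *m A) i j / k`!%:R) t @ \oo --> (rexp t M *m A) i j.
Proof.
rewrite mxE.
have -> : pseries (fun k => (M ^+ k *m A) i j / k`!%:R) t =
    (fun n => \sum_l pseries (expmx_coef M i l) t n * A l j).
  apply/funext => n; rewrite /pseries /series /=.
  under [RHS]eq_bigr do rewrite mulr_suml.
  rewrite exchange_big/=; apply: eq_bigr => k _.
  rewrite mxE !mulr_suml; apply: eq_bigr => l _.
  by rewrite /expmx_coef; ring.
apply: cvg_sumr => l; rewrite mxE; apply: cvgMr_tmp; exact: is_cvg_expmx.
Qed.

(** Both sides are limits of the same series, since M M^k = M^k M. *)
Lemma rexp_comm M t : M *m rexp t M = rexp t M *m M.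
Proof.
apply/matrixP => i j.
rewrite -(cvg_lim (@Rhausdorff R) (@cvg_expmx_mull M M i j t)).
have -> : (fun k => (M *m M ^+ k) i j / k`!%:R) = (fun k => (M ^+ k *m M) i j / k`!%:R).
  by apply/funext => k; rewrite -[_ *m _]exprS -[_ ^+ k *m M]exprSr.
by apply/cvg_lim => //; exact: cvg_expmx_mulr.
Qed.

Lemma is_derive_rexp M i j (t : R) :
  is_derive t 1 (fun s => rexp s M i j) ((M *m rexp t M) i j).
Proof.
have e1 : pseries_diffs (expmx_coef M i j) = fun k => (M *m M ^+ k) i j / k`!%:R.
  by apply/funext => k; rewrite expmx_coef_diffs exprS.
have e2 : pseries_diffs (pseries_diffs (expmx_coef M i j)) =
    fun k => ((M *m M) *m M ^+ k) i j / k`!%:R.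
  apply/funext => k; rewrite e1 /pseries_diffs.
  rewrite -[M *m M ^+ k.+1]exprS -[M *m M]/(M ^+ 2) -[_ *m _]exprD.
  by rewrite factS natrM invfM mulrCA mulVKf.
have -> : (fun s => rexp s M i j) = fun s => limn (pseries (expmx_coef M i j) s).
  by apply/funext => s; rewrite mxE.
rewrite -(cvg_lim _ (@cvg_expmx_mull M M i j t))// -e1.
(* Termwise differentiation at t asks for convergence of the series and of its first two derivatives
   at a point of modulus larger than |t|, here |t| + 1. *)
apply: (@pseries_snd_diffs _ _ (`|t| + 1)).
- exact: is_cvg_expmx.
- by rewrite e1; apply: cvgP; exact: cvg_expmx_mull.
- by rewrite e2; apply: cvgP; exact: cvg_expmx_mull.
- by rewrite [ltRHS]ger0_norm ?addr_ge0// ltrDl.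
Qed.

Lemma rexp0 M : rexp 0 M = 1%:M.
Proof.
apply/matrixP => i j; rewrite [LHS]mxE; apply/cvg_lim => //.
(* At t = 0 only the term k = 0 survives, so the partial sums are constant from index 1 on; the one
   at index 0 is empty. *)
apply: cvg_near_cst; exists 1%N => //= n /= n0.
rewrite /pseries /series /= big_ltn// big_nat_cond big1 ?addr0.
  by rewrite /expmx_coef !expr0 divr1 mulr1.
by move=> k /andP[/andP[k0 _] _]; rewrite expr0n gtn_eqF// mulr0.
Qed.

Lemma continuous_rexp M i j : continuous (fun s => rexp s M i j).
Proof. exact: is_derive_continuous (is_derive_rexp M i j). Qed.

(** The derivative of the left side in s is zero, so the product equals its value at s = 0. The
    group law follows without multiplying series. *)
Lemma rexpB_mul M (c s : R) : rexp (c - s) M *m rexp s M = rexp c M.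
Proof.
rewrite -[in RHS](subr0 c) -[RHS]mulmx1 -(rexp0 M).
apply/matrixP => i j.
apply: (@is_derive_0_is_cst _ (fun x : R => (rexp (c - x) M *m rexp x M) i j)) => x.
have -> : (fun x => (rexp (c - x) M *m rexp x M) i j) =
    \sum_(l < N) ((fun x => rexp (c - x) M i l) * (fun x => rexp x M l j)).
  by apply/funext => y; rewrite mxE fct_sumE.
(* Zero is written as the sum given by the product rule; its two halves cancel because [M] commutes
   with its exponential. *)
have -> : 0 = \sum_(l < N) (rexp (c - x) M i l *: (M *m rexp x M) l j +
     rexp x M l j *: - (M *m rexp (c - x) M) i l).
  rewrite big_split/= -[X in X + _]/(\sum_l rexp (c - x) M i l * (M *m rexp x M) l j).
  under [X in _ + X]eq_bigr do rewrite rexp_comm scalerN [_ *: _]mulrC.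
  rewrite sumrN.
  have -> : \sum_l rexp (c - x) M i l * (M *m rexp x M) l j =
      (rexp (c - x) M *m (M *m rexp x M)) i j.
    by rewrite [RHS]mxE.
  have -> : \sum_l (rexp (c - x) M *m M) i l * rexp x M l j =
      (rexp (c - x) M *m M *m rexp x M) i j.
    by rewrite [RHS]mxE.
  by rewrite mulmxA subrr.
apply: is_derive_sum => l; apply: is_deriveM.
rewrite -mulrN1; apply: (@is_derive1_comp _ (fun y => rexp y M i l) (fun y => c - y)).
  exact: is_derive_rexp.
  by apply: is_derive_eq; rewrite add0r mul1r.
exact: is_derive_rexp.
Qed.

Lemma rexpD M (a b : R) : rexp (a + b) M = rexp a M *m rexp b M.
Proof. by rewrite -[in LHS](rexpB_mul M _ b) addrK. Qed.

Lemma rexpNK M t : rexp t M *m rexp (- t) M = 1%:M.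
Proof. by rewrite -rexpD subrr rexp0. Qed.

End RealMatrixExponential.

(** * Linear differential equations with locally integrable input *)

Section VectorIntegral.
Context {R : realType}.

Definition loc_integrable_vec {p} (g : R -> 'cV[R]_p) : Prop :=
  forall j, loc_integrable (fun s => g s j 0).

Definition int0v {p} (g : R -> 'cV[R]_p) (t : R) : 'cV[R]_p :=
  \col_j int0 (fun s => g s j 0) t.

Lemma eq_int0v p (f g : R -> 'cV[R]_p) (t : R) :
  (forall s, 0 <= s <= t -> f s = g s) -> int0v f t = int0v g t.
Proof. by move=> fg; apply/colP => j; rewrite !mxE; apply: eq_int0 => s /fg ->. Qed.

Lemma loc_integrable_vecM p q (P : R -> 'M[R]_(p, q)) (h : R -> 'cV[R]_q) :
    (forall i j, continuous (fun s => P s i j)) -> loc_integrable_vec h ->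
  loc_integrable_vec (fun s => P s *m h s).
Proof.
move=> cP hi i.
apply: eq_loc_integrable (_ : loc_integrable (fun s => \sum_l P s i l * h s l 0)).
  by move=> s _; rewrite mxE.
by apply: loc_integrable_sum => l; exact: loc_integrableM.
Qed.

Lemma int0vM p q (A : 'M[R]_(p, q)) (h : R -> 'cV[R]_q) (t : R) :
    0 <= t -> loc_integrable_vec h ->
  int0v (fun s => A *m h s) t = A *m int0v h t.
Proof.
move=> t0 hi; apply/colP => i; rewrite !mxE.
rewrite (@eq_int0 _ _ (fun s => \sum_l A i l * h s l 0)); last first.
  by move=> s _; rewrite mxE.
rewrite int0_sum//; last first.
  move=> l; apply: (@loc_integrableM _ (fun=> A i l)); last exact: hi.
  by move=> ?; exact: cvg_cst.
by apply: eq_bigr => l _; rewrite int0Zl ?mxE.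
Qed.

(** The scalar rule is applied to each pair P_il, h_l and summed over l. *)
Lemma int0v_product_rule p q (P P' : R -> 'M[R]_(p, q)) (h : R -> 'cV[R]_q)
    (c : 'cV[R]_q) :
    (forall i j (x : R), is_derive x 1 (fun s => P s i j) (P' x i j)) ->
    (forall i j, continuous (fun s => P' s i j)) -> loc_integrable_vec h ->
  let H t := c + int0v h t in
  loc_integrable_vec (fun s => P' s *m H s + P s *m h s) /\
  forall t, 0 <= t ->
    int0v (fun s => P' s *m H s + P s *m h s) t = P t *m H t - P 0 *m c.
Proof.
move=> dP cP' hi H.
pose r i l s := P' s i l * (c l 0 + int0 (fun s => h s l 0) s) + P s i l * h s l 0.
have rE i s : (P' s *m H s + P s *m h s) i 0 = \sum_l r i l s.
  by rewrite !mxE -big_split; apply: eq_bigr => l _; rewrite /= !mxE.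
have rule i l := int0_product_rule (c l 0) (dP i l) (cP' i l) (hi l).
split.
  move=> i; apply: eq_loc_integrable (_ : loc_integrable (fun s => \sum_l r i l s)).
    by move=> s _; rewrite rE.
  by apply: loc_integrable_sum => l; exact: (rule i l).1.
move=> t t0; apply/colP => i; rewrite mxE.
rewrite (@eq_int0 _ _ (fun s => \sum_l r i l s)); last by move=> s _; rewrite rE.
rewrite int0_sum//; last by move=> l; exact: (rule i l).1.
rewrite !mxE -sumrB; apply: eq_bigr => l _.
by rewrite /r (rule i l).2// !mxE.
Qed.

End VectorIntegral.

Section RealLinearODE.
Context {R : realType} {N : nat}.
Variables (M : 'M[R]_N) (g : R -> 'cV[R]_N) (c : 'cV[R]_N).

Definition rsol (x : R -> 'cV[R]_N) : Prop :=
  let rhs s := M *m x s + g s in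
  loc_integrable_vec rhs /\ forall t, 0 <= t -> x t = c + int0v rhs t.

(** With e^{tM} outside, the integrand does not depend on t and the product rule applies;
    [variation_of_constantsE] recovers the convolution form. *)
Definition variation_of_constants (t : R) : 'cV[R]_N :=
  rexp t M *m (c + int0v (fun s => rexp (- s) M *m g s) t).

Let is_derive_rexpN i j (x : R) :
  is_derive x 1 (fun s => rexp (- s) M i j) ((- (rexp (- x) M *m M)) i j).
Proof.
rewrite mxE -mulrN1 -rexp_comm.
apply: (@is_derive1_comp _ (fun y => rexp y M i j) -%R).
exact: is_derive_rexp.
Qed.

Let continuous_mulmx_rexp i j : continuous (fun s => (M *m rexp s M) i j).
Proof.
have -> : (fun s => (M *m rexp s M) i j) = fun s => \sum_l M i l * rexp s M l j.
  by apply/funext => s; rewrite mxE.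
move=> x; apply: cvg_sumr => l; apply: cvgMl_tmp; exact: continuous_rexp.
Qed.

Let continuous_rexpN i j : continuous (fun s : R => rexp (- s) M i j).
Proof. exact: is_derive_continuous (is_derive_rexpN i j). Qed.

Let continuous_rexpN_mulmx i j :
  continuous (fun s => (- (rexp (- s) M *m M)) i j).
Proof.
have -> : (fun s => (- (rexp (- s) M *m M)) i j) = fun s => - (M *m rexp (- s) M) i j.
  by apply/funext => s; rewrite rexp_comm [LHS]mxE.
move=> x; apply: cvgN.
apply: (@continuous_comp _ _ _ -%R (fun s => (M *m rexp s M) i j)).
  exact: opp_continuous.
exact: continuous_mulmx_rexp.
Qed.

Lemma variation_of_constantsE t : loc_integrable_vec g -> 0 <= t ->
  variation_of_constants t =
  rexp t M *m c + int0v (fun s => rexp (t - s) M *m g s) t.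
Proof.
move=> gi t0; rewrite /variation_of_constants mulmxDr -int0vM//; last first.
  exact: loc_integrable_vecM.
by congr (_ + _); apply: eq_int0v => s _; rewrite mulmxA -rexpD.
Qed.

Lemma rsol_variation_of_constants : loc_integrable_vec g ->
  rsol variation_of_constants.
Proof.
move=> gi.
have hi : loc_integrable_vec (fun s => rexp (- s) M *m g s).
  exact: loc_integrable_vecM.
have [i1 i2] := int0v_product_rule c (is_derive_rexp M)
  continuous_mulmx_rexp hi.
(* The integrand of the product rule is the right-hand side of the equation, since e^{sM} e^{-sM} =
   I. *)
have E s : M *m rexp s M *m (c + int0v (fun s => rexp (- s) M *m g s) s) +
    rexp s M *m (rexp (- s) M *m g s) = M *m variation_of_constants s + g s.
  by rewrite [rexp s M *m (_ *m _)]mulmxA rexpNK mul1mx -mulmxA.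
split.
  by move=> j; apply: eq_loc_integrable (i1 j) => s _; rewrite E.
move=> t t0; by rewrite -(eq_int0v (fun s _ => E s)) i2// rexp0 mul1mx addrC subrK.
Qed.

Lemma rsol_unique x : rsol x ->
  forall t, 0 <= t -> x t = variation_of_constants t.
Proof.
move=> [ri xE] t t0.
have [_ /(_ t t0)] := int0v_product_rule c is_derive_rexpN continuous_rexpN_mulmx ri.
rewrite -xE// oppr0 rexp0 mul1mx.
(* For s >= 0 the equation turns the constant plus the integral back into x s; the terms in M x then
   cancel and e^{-sM} g s is left. *)
rewrite (@eq_int0v _ _ _ (fun s => rexp (- s) M *m g s)); last first.
  by move=> s /andP[s0 _]; rewrite -xE// mulNmx mulmxDr addrA -mulmxA addNr add0r.
move=> /eqP; rewrite eq_sym subr_eq addrC => /eqP e.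
by rewrite /variation_of_constants -e mulmxA rexpNK mul1mx.
Qed.

End RealLinearODE.

(** Serves to transfer the solution property to the closed formula for [X], whose agreement with
    [variation_of_constants] is established for t >= 0. *)
Lemma eq_rsol (R : realType) N (M : 'M[R]_N) g c x y : (forall t, 0 <= t -> x t = y t) ->
  rsol M g c x -> rsol M g c y.
Proof.
move=> xy [xi xE]; split.
  by move=> j; apply: eq_loc_integrable (xi j) => s s0; rewrite xy.
move=> t t0; rewrite -xy// xE//; congr (_ + _).
by apply: eq_int0v => s /andP[s0 _]; rewrite xy.
Qed.

(** * Limits of complex matrices *)

Section ComplexMatrixLimits.
Context {R : realType}.
Notation Re := (@complex.Re R).
Notation Im := (@complex.Im R).

(** Convergence by real and imaginary parts is the form in which real power series deliver it;
    [ccvg_cvg] and [mcvg_cvg] turn it into convergence in the topology. *)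
Definition ccvg (u : nat -> R[i]) (l : R[i]) : Prop :=
  (fun k => Re (u k)) @ \oo --> Re l /\ (fun k => Im (u k)) @ \oo --> Im l.

Definition mcvg {p q} (u : nat -> 'M[R[i]]_(p, q)) (l : 'M[R[i]]_(p, q)) : Prop :=
  forall i j, ccvg (fun k => u k i j) (l i j).

Lemma Re_mul (x y : R[i]) : Re (x * y) = Re x * Re y - Im x * Im y.
Proof. by case: x => a b; case: y. Qed.

Lemma Im_mul (x y : R[i]) : Im (x * y) = Re x * Im y + Im x * Re y.
Proof. by case: x => a b; case: y => c d /=; rewrite addrC. Qed.

Lemma Re_add (x y : R[i]) : Re (x + y) = Re x + Re y.
Proof. by case: x => a b; case: y. Qed.

Lemma Im_add (x y : R[i]) : Im (x + y) = Im x + Im y.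
Proof. by case: x => a b; case: y. Qed.

Lemma Re_conj (x : R[i]) : Re (conjc x) = Re x.
Proof. by case: x. Qed.

Lemma Im_conj (x : R[i]) : Im (conjc x) = - Im x.
Proof. by case: x. Qed.

Lemma Re_sum (I : Type) (r : seq I) (F : I -> R[i]) :
  Re (\sum_(i <- r) F i) = \sum_(i <- r) Re (F i).
Proof. exact: (big_morph Re Re_add). Qed.

Lemma Im_sum (I : Type) (r : seq I) (F : I -> R[i]) :
  Im (\sum_(i <- r) F i) = \sum_(i <- r) Im (F i).
Proof. exact: (big_morph Im Im_add). Qed.

Lemma Re_realZ (a : R) (x : R[i]) : Re (a%:C * x) = a * Re x.
Proof. by rewrite Re_mul /= mul0r subr0. Qed.

Lemma Im_realZ (a : R) (x : R[i]) : Im (a%:C * x) = a * Im x.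
Proof. by rewrite Im_mul /= mul0r addr0. Qed.

Lemma ccvg_cvg (u : nat -> R[i]) (l : R[i]) : ccvg u l -> u @ \oo --> l.
Proof.
move=> [ur ui]; apply/cvgrPdist_lt => e e0.
(* A positive element of [R[i]] is real, so the radius can be halved between the real and the
   imaginary part. *)
have eR : e = (Re e)%:C by rewrite RRe_real// ger0_real// ltW.
have re0 : 0 < Re e by move: e0; rewrite eR ltcR.
move/cvgrPdist_lt : ur => /(_ (Re e / 2)); rewrite divr_gt0// => /(_ isT) ur.
move/cvgrPdist_lt : ui => /(_ (Re e / 2)); rewrite divr_gt0// => /(_ isT) ui.
near=> k.
have -> : l - u k = (Re l - Re (u k))%:C + 'i * (Im l - Im (u k))%:C.
  by rewrite [LHS]complexE /=; case: (l) (u k) => a b [].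
apply: le_lt_trans (ler_normD _ _) _; rewrite normrM.
have -> : `|'i%C : R[i]| = 1 by rewrite normc_def /= expr0n add0r expr1n sqrtr1.
rewrite mul1r !normc_def /= !expr0n !addr0 !sqrtr_sqr -rmorphD/= eR ltcR.
rewrite [ltRHS](splitr (Re e)) ltrD//; near: k; [exact: ur|exact: ui].
Unshelve. all: by end_near. Qed.

(** Matrix neighbourhoods are products of neighbourhoods of finitely many entries. *)
Lemma mcvg_cvg p q (u : nat -> 'M[R[i]]_(p, q)) l : mcvg u l -> u @ \oo --> l.
Proof.
move=> ul A [P lP PA].
have : \forall k \near \oo, forall i j, P i j (u k i j).
  apply: filter_forall => i; apply: filter_forall => j.
  exact: (ccvg_cvg (ul i j)) (lP i j).
by apply: filterS => k Pk; exact: PA.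
Qed.

Lemma nbhs_mx_entry (T : topologicalType) p q (A : 'M[T]_(p, q)) i j (U : set T) :
  nbhs (A i j) U -> nbhs A [set C : 'M[T]_(p, q) | U (C i j)].
Proof.
move=> AU; exists (fun i' j' => if (i' == i) && (j' == j) then U else setT).
  move=> i' j' /=; case: ifPn => [/andP[/eqP-> /eqP->] //|_]; exact: filterT.
by move=> C /(_ i j) /=; rewrite !eqxx.
Qed.

(** Uniqueness of limits is what allows the [lim] in [biexp] and [mexp] to be computed; it is
    inherited from the entries. *)
Lemma complexmx_hausdorff p q : hausdorff_space 'M[R[i]]_(p, q).
Proof.
move=> A B AB; apply/matrixP => i j.
apply: (@norm_hausdorff _ (R[i]^o)) => U V AU BV.
have [C [CU CV]] := AB _ _ (nbhs_mx_entry AU) (nbhs_mx_entry BV).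
by exists (C i j).
Qed.

Lemma mcvg_lim p q (u : nat -> 'M[R[i]]_(p, q)) l : mcvg u l -> lim (u @ \oo) = l.
Proof. by move=> ul; apply: cvg_lim (mcvg_cvg ul); exact: complexmx_hausdorff. Qed.

Lemma ccvg_sum (I : Type) (r : seq I) (u : I -> nat -> R[i]) (l : I -> R[i]) :
  (forall i, ccvg (u i) (l i)) ->
  ccvg (fun n => \sum_(i <- r) u i n) (\sum_(i <- r) l i).
Proof.
move=> ul; split.
  rewrite Re_sum; under eq_fun do rewrite Re_sum.
  by apply: cvg_sumr => i; case: (ul i).
rewrite Im_sum; under eq_fun do rewrite Im_sum.
by apply: cvg_sumr => i; case: (ul i).
Qed.

Lemma ccvgMr (u : nat -> R[i]) l c : ccvg u l -> ccvg (fun k => u k * c) (l * c).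
Proof.
move=> [ur ui]; split.
  rewrite Re_mul; under eq_fun do rewrite Re_mul.
  by apply: cvgB; apply: cvgMr_tmp.
rewrite Im_mul; under eq_fun do rewrite Im_mul.
by apply: cvgD; apply: cvgMr_tmp.
Qed.

Lemma mcvgMr p q r (u : nat -> 'M[R[i]]_(p, q)) l (C : 'M[R[i]]_(q, r)) :
  mcvg u l -> mcvg (fun k => u k *m C) (l *m C).
Proof.
move=> ul i j; rewrite mxE; under eq_fun do rewrite mxE.
by apply: ccvg_sum => k; apply: ccvgMr.
Qed.

Lemma mcvg_conj p q (u : nat -> 'M[R[i]]_(p, q)) l :
  mcvg u l -> mcvg (fun k => Defs.conjmx (u k)) (Defs.conjmx l).
Proof.
move=> ul i j; have [ur ui] := ul i j; rewrite mxE; under eq_fun do rewrite mxE.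
split; first by rewrite Re_conj; under eq_fun do rewrite Re_conj.
by rewrite Im_conj; under eq_fun do rewrite Im_conj; exact: cvgN.
Qed.

Lemma mcvg_bimx n (u1 u2 : nat -> 'M[R[i]]_n) l1 l2 (v : 'cV[R[i]]_n) :
  mcvg u1 l1 -> mcvg u2 l2 ->
  mcvg (fun k => bimx (u1 k) (u2 k) v) (bimx l1 l2 v).
Proof.
move=> ul1 ul2 i j.
have [ar ai] := mcvgMr v ul1 i j.
have [br bi] := mcvgMr (Defs.conjmx v) (mcvg_conj ul2) i j.
split.
  rewrite [X in Re X]mxE Re_add; under eq_fun do rewrite [X in Re X]mxE Re_add.
  exact: cvgD.
rewrite [X in Im X]mxE Im_add; under eq_fun do rewrite [X in Im X]mxE Im_add.
exact: cvgD.
Qed.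

End ComplexMatrixLimits.

(** * Real coordinates *)

Section Realification.
Context {R : realType}.
Notation Re := (@complex.Re R).
Notation Im := (@complex.Im R).

Definition realv {p} (x : 'cV[R[i]]_p) : 'cV[R]_(p + p) :=
  col_mx (map_mx Re x) (map_mx Im x).

Definition complexv {p} (w : 'cV[R]_(p + p)) : 'cV[R[i]]_p :=
  \col_j (usubmx w j 0 +i* dsubmx w j 0).

(** The matrix of {A1, A2} in the coordinates (Re x, Im x), with A1 = a + ib and A2 = c + id; the
    signs of c and d come from A2^# x^# = (A2 x)^#. *)
Definition realmx {p q} (A1 A2 : 'M[R[i]]_(p, q)) : 'M[R]_(p + p, q + q) :=
  let a := map_mx Re A1 in let b := map_mx Im A1 in
  let c := map_mx Re A2 in let d := map_mx Im A2 in
  block_mx (a + c) (- b - d) (b - d) (a - c).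

Lemma realv_up p (x : 'cV[R[i]]_p) j : realv x (lshift p j) 0 = Re (x j 0).
Proof. by rewrite col_mxEu mxE. Qed.

Lemma realv_down p (x : 'cV[R[i]]_p) j : realv x (rshift p j) 0 = Im (x j 0).
Proof. by rewrite col_mxEd mxE. Qed.

Lemma realvK p : cancel (@realv p) complexv.
Proof.
move=> x; apply/colP => j; rewrite mxE col_mxKu col_mxKd !mxE.
by case: (x j 0).
Qed.

Lemma complexvK p : cancel complexv (@realv p).
Proof.
move=> w; rewrite -[RHS]vsubmxK; congr col_mx; apply/colP => j; rewrite !mxE//.
Qed.

Lemma realvD p (x y : 'cV[R[i]]_p) : realv (x + y) = realv x + realv y.
Proof.
by rewrite /realv add_col_mx; congr col_mx; apply/colP => j;
  rewrite !mxE ?Re_add ?Im_add.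
Qed.

Lemma realv_bimx p q (A1 A2 : 'M[R[i]]_(p, q)) x :
  realv (bimx A1 A2 x) = realmx A1 A2 *m realv x.
Proof.
rewrite /realv /realmx mul_block_col; congr col_mx; apply/colP => j.
  rewrite !mxE Re_add !Re_sum -!big_split/=; apply: eq_bigr => l _.
  by rewrite !mxE !Re_mul !Re_conj !Im_conj; ring.
rewrite !mxE Im_add !Im_sum -!big_split/=; apply: eq_bigr => l _.
by rewrite !mxE !Im_mul !Re_conj !Im_conj; ring.
Qed.

Lemma realv_bipow n (A1 A2 : 'M[R[i]]_n) k x :
  realv (bipow A1 A2 k x) = realmx A1 A2 ^+ k *m realv x.
Proof.
elim: k => [|k IH]; first by rewrite expr0 mul1mx.
by rewrite /bipow iterS realv_bimx -/(bipow _ _ _ _) IH exprS mulmxA.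
Qed.

(** The scalars t^k / k! are real, so passing to real coordinates commutes with partial sums and
    each coordinate is a series covered by [cvg_expmx_mulr]. *)
Lemma mcvg_biexp_series n (A1 A2 : 'M[R[i]]_n) x t :
  mcvg (series (fun k : nat => (t ^+ k / k`!%:R)%:C *: bipow A1 A2 k x))
       (complexv (rexp t (realmx A1 A2) *m realv x)).
Proof.
move=> j i; rewrite (ord1 i) {i}.
set M := realmx _ _; set w := realv x.
have rE k i : t ^+ k / k`!%:R * realv (bipow A1 A2 k x) i 0 =
    (M ^+ k *m w) i 0 / k`!%:R * t ^+ k.
  by rewrite realv_bipow; ring.
split.
  rewrite -realv_up complexvK.
  have -> : (fun k => Re (series (fun k : nat =>
      (t ^+ k / k`!%:R)%:C *: bipow A1 A2 k x) k j 0)) =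
      pseries (fun k => (M ^+ k *m w) (lshift n j) 0 / k`!%:R) t.
    apply/funext => N; rewrite /pseries /series /= summxE Re_sum.
    by apply: eq_bigr => k _; rewrite mxE Re_realZ -realv_up rE.
  exact: cvg_expmx_mulr.
rewrite -realv_down complexvK.
have -> : (fun k => Im (series (fun k : nat =>
    (t ^+ k / k`!%:R)%:C *: bipow A1 A2 k x) k j 0)) =
    pseries (fun k => (M ^+ k *m w) (rshift n j) 0 / k`!%:R) t.
  apply/funext => N; rewrite /pseries /series /= summxE Im_sum.
  by apply: eq_bigr => k _; rewrite mxE Im_realZ -realv_down rE.
exact: cvg_expmx_mulr.
Qed.

Lemma realv_biexp n (A1 A2 : 'M[R[i]]_n) x t :
  realv (biexp t A1 A2 x) = rexp t (realmx A1 A2) *m realv x.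
Proof. by rewrite /biexp (mcvg_lim (mcvg_biexp_series A1 A2 x t)) complexvK. Qed.

Lemma realv_cint p (f : R -> 'cV[R[i]]_p) t :
  realv (cint t f) = int0v (fun s => realv (f s)) t.
Proof.
apply/colP => i; rewrite [RHS]mxE; case: (split_ordP i) => j ->.
  by rewrite realv_up mxE; apply: eq_int0 => s _; rewrite realv_up.
by rewrite realv_down mxE; apply: eq_int0 => s _; rewrite realv_down.
Qed.

Lemma locintP p (f : R -> 'cV[R[i]]_p) :
  locint f <-> loc_integrable_vec (fun s => realv (f s)).
Proof.
split=> fi.
  move=> i; case: (split_ordP i) => j ->.
    apply: (@eq_loc_integrable _ (fun s => Re (f s j 0))) => [s _|t t0].
      by rewrite realv_up.
    by case: (fi t t0 j).
  apply: (@eq_loc_integrable _ (fun s => Im (f s j 0))) => [s _|t t0].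
    by rewrite realv_down.
  by case: (fi t t0 j).
move=> t t0 j; split.
  apply: (eq_loc_integrable _ (fi (lshift p j))) t0 => s _; exact: realv_up.
apply: (eq_loc_integrable _ (fi (rshift p j))) t0 => s _; exact: realv_down.
Qed.

(** [realv] is injective and carries sums, bimatrices and integrals to their real counterparts. *)
Lemma csolP n m (A1 A2 : 'M[R[i]]_n) (B1 B2 : 'M[R[i]]_(n, m)) x0 u x :
  csol A1 A2 B1 B2 x0 u x <->
  rsol (realmx A1 A2) (fun s => realv (bimx B1 B2 (u s))) (realv x0)
       (fun t => realv (x t)).
Proof.
have E s : realmx A1 A2 *m realv (x s) + realv (bimx B1 B2 (u s)) =
    realv (bimx A1 A2 (x s) + bimx B1 B2 (u s)).
  by rewrite realvD (realv_bimx A1).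
rewrite /csol /rsol (funext E).
split => -[fi fE]; split; try exact/locintP.
  by move=> t t0; rewrite {1}fE// realvD realv_cint.
by move=> t t0; apply: (can_inj (@realvK _)); rewrite realvD realv_cint; exact: fE.
Qed.

End Realification.

(** * The complex lifting *)

Section Lifting.
Context {R : realType}.

Lemma conjmxD p q (x y : 'M[R[i]]_(p, q)) :
  Defs.conjmx (x + y) = Defs.conjmx x + Defs.conjmx y.
Proof. by apply/matrixP => i j; rewrite !mxE rmorphD. Qed.

Lemma conjmxM p q r (x : 'M[R[i]]_(p, q)) (y : 'M[R[i]]_(q, r)) :
  Defs.conjmx (x *m y) = Defs.conjmx x *m Defs.conjmx y.
Proof.
apply/matrixP => i j; rewrite !mxE rmorph_sum; apply: eq_bigr => k _.
by rewrite !mxE rmorphM.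
Qed.

Lemma conjmxK p q : involutive (@Defs.conjmx R p q).
Proof. by move=> x; apply/matrixP => i j; rewrite !mxE conjcK. Qed.

Lemma conjmx_realZ p q (a : R) (x : 'M[R[i]]_(p, q)) :
  Defs.conjmx (a%:C *: x) = a%:C *: Defs.conjmx x.
Proof. by apply/matrixP => i j; rewrite !mxE rmorphM; congr (_ * _); exact: conjc_real. Qed.

Lemma conjmx0 p q : Defs.conjmx (0 : 'M[R[i]]_(p, q)) = 0.
Proof. by apply/matrixP => i j; rewrite !mxE conjc0. Qed.

Lemma bimxD p q (A1 A2 : 'M[R[i]]_(p, q)) x y :
  bimx A1 A2 (x + y) = bimx A1 A2 x + bimx A1 A2 y.
Proof. by rewrite /bimx conjmxD !mulmxDr addrACA. Qed.

Lemma bimx0 p q (A1 A2 : 'M[R[i]]_(p, q)) : bimx A1 A2 0 = 0.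
Proof. by rewrite /bimx conjmx0 !mulmx0 addr0. Qed.

(* For P = exp(t lift) or lift^t this is the bimatrix {Phi_1(t), Phi_2(t)}. *)
Definition bimx_of_lift {n} (P : 'M[R[i]]_(n + n)) : 'cV[R[i]]_n -> 'cV[R[i]]_n :=
  let Q := P *m col_mx 1%:M 0 in bimx (usubmx Q) (dsubmx Q).

Lemma bimx_of_liftD n (P Q : 'M[R[i]]_(n + n)) v :
  bimx_of_lift (P + Q) v = bimx_of_lift P v + bimx_of_lift Q v.
Proof.
by rewrite /bimx_of_lift mulmxDl !linearD /bimx conjmxD !mulmxDl addrACA.
Qed.

Lemma bimx_of_lift0 n v : bimx_of_lift (0 : 'M[R[i]]_(n + n)) v = 0.
Proof. by rewrite /bimx_of_lift mul0mx !linear0 /bimx conjmx0 !mul0mx addr0. Qed.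

(** The scalar is real because the lower block enters conjugated; the coefficients t^k / k! are of
    this kind. *)
Lemma bimx_of_lift_realZ n (a : R) (P : 'M[R[i]]_(n + n)) v :
  bimx_of_lift (a%:C *: P) v = a%:C *: bimx_of_lift P v.
Proof.
by rewrite /bimx_of_lift -scalemxAl !linearZ /bimx /= conjmx_realZ -!scalemxAl scalerDr.
Qed.

(** The lifting sends the column [P; Q] to [A1 P + A2^# Q; A2 P + A1^# Q], the coefficients of the
    composition {A1, A2}{P, Q}. The induction starts from [I; 0], the identity bimatrix. *)
Lemma bimx_of_lift_pow n (A1 A2 : 'M[R[i]]_n) k v :
  bimx_of_lift (bilift A1 A2 ^+ k) v = bipow A1 A2 k v.
Proof.
elim: k => [|k IH].
  by rewrite expr0 /bimx_of_lift mul1mx col_mxKu col_mxKd /bimx conjmx0 mul1mx mul0mx addr0.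
rewrite /bipow iterS -/(bipow _ _ _ _) -IH exprS /bimx_of_lift -mulmxA.
set Q := _ ^+ k *m _; rewrite -[in LHS](vsubmxK Q) mul_block_col col_mxKu col_mxKd.
rewrite /bimx !conjmxD !conjmxM !conjmxK !mulmxDl !mulmxDr !mulmxA.
by rewrite addrACA [RHS]addrACA [X in _ + X]addrC.
Qed.

(** Column j of M^k is {M, 0}^k applied to the j-th basis vector, so convergence is inherited from
    the bimatrix series. *)
Lemma mcvg_mexp_series n (M : 'M[R[i]]_n) t :
  mcvg (series (fun k : nat => (t ^+ k / k`!%:R)%:C *: M ^+ k)) (mexp t M).
Proof.
have powE k j : bipow M 0 k (col j 1%:M) = col j (M ^+ k).
  elim: k => [|k IH]; first by rewrite expr0.
  by rewrite /bipow iterS -/(bipow _ _ _ _) IH /bimx conjmx0 mul0mx addr0 exprS !colE mulmxA.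
pose L := \matrix_(i, j) (complexv (rexp t (realmx M 0) *m realv (col j 1%:M))) i 0.
suff ML : mcvg (series (fun k : nat => (t ^+ k / k`!%:R)%:C *: M ^+ k)) L.
  by rewrite /mexp (mcvg_lim ML).
move=> i j; rewrite mxE.
have -> : (fun k => series (fun k : nat => (t ^+ k / k`!%:R)%:C *: M ^+ k) k i j) =
    fun k => series (fun k : nat => (t ^+ k / k`!%:R)%:C *: bipow M 0 k (col j 1%:M)) k i 0.
  apply/funext => N; rewrite /series /= !summxE; apply: eq_bigr => k _.
  by rewrite powE !mxE.
exact: mcvg_biexp_series.
Qed.

Lemma bimx_PhiC n (A1 A2 : 'M[R[i]]_n) t v :
  bimx (Phi1C A1 A2 t) (Phi2C A1 A2 t) v = biexp t A1 A2 v.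
Proof.
(* By uniqueness of limits it suffices that the partial sums of [biexp] converge to the left side;
   they are the images under [bimx_of_lift] of the partial sums for the lifting. *)
rewrite -[LHS]/(bimx_of_lift (mexp t (bilift A1 A2)) v); apply/esym/mcvg_lim.
have -> : series (fun k : nat => (t ^+ k / k`!%:R)%:C *: bipow A1 A2 k v) =
    fun N => bimx_of_lift
      (series (fun k : nat => (t ^+ k / k`!%:R)%:C *: bilift A1 A2 ^+ k) N) v.
  apply/funext => N; rewrite /series /=.
  rewrite (big_morph (bimx_of_lift^~ v) (fun P Q => bimx_of_liftD P Q v) (bimx_of_lift0 v)).
  by apply: eq_bigr => k _; rewrite bimx_of_lift_realZ bimx_of_lift_pow.
have Ec := mcvgMr (col_mx 1%:M 0 : 'M[R[i]]_(n + n, n)) (mcvg_mexp_series (bilift A1 A2) t).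
have uE (Q : 'M[R[i]]_(n + n, n)) i j : usubmx Q i j = Q (lshift n i) j by rewrite mxE.
have dE (Q : 'M[R[i]]_(n + n, n)) i j : dsubmx Q i j = Q (rshift n i) j by rewrite mxE.
apply: mcvg_bimx => i j.
  by rewrite uE (funext (fun k => uE _ i j)); exact: Ec.
by rewrite dE (funext (fun k => dE _ i j)); exact: Ec.
Qed.

Lemma bimx_PhiD n (A1 A2 : 'M[R[i]]_n) k v :
  bimx (Phi1D A1 A2 k) (Phi2D A1 A2 k) v = bipow A1 A2 k v.
Proof. exact: bimx_of_lift_pow. Qed.

End Lifting.

(** * Discrete solutions, and the continuous solution formula in real coordinates *)

Section Solutions.
Context {R : realType}.
Variables (n m : nat) (A1 A2 : 'M[R[i]]_n) (B1 B2 : 'M[R[i]]_(n, m)).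
Variable x0 : 'cV[R[i]]_n.

Lemma dsol_unique u x y : dsol A1 A2 B1 B2 x0 u x -> dsol A1 A2 B1 B2 x0 u y -> x =1 y.
Proof.
move=> [xE xS] [yE yS]; elim=> [|t IH]; first by rewrite xE yE.
by rewrite xS yS IH.
Qed.

Lemma dsol_variation_of_constants u :
  dsol A1 A2 B1 B2 x0 u (fun t => bipow A1 A2 t x0
    + \sum_(0 <= i < t) bipow A1 A2 (t - 1 - i)%N (bimx B1 B2 (u i))).
Proof.
split; first by rewrite big_geq// addr0.
(* The new summand i = t has exponent 0 and gives {B1, B2}u(t); applying the additive map {A1, A2}
   raises every other exponent by one. *)
move=> t; rewrite big_nat_recr//= subn1 subnn bimxD addrA.
rewrite -[bipow _ _ 0 _]/(bimx B1 B2 (u t)); congr (_ + _ + _).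
rewrite (big_morph _ (bimxD A1 A2) (bimx0 A1 A2)); apply: eq_big_nat => i /andP[_ it].
(* Truncated subtraction is harmless here: i < t gives (t - 1 - i) + 1 = t - i. *)
by rewrite /bipow -iterS -subnDA add1n subnSK.
Qed.

Lemma loc_integrable_bimx (u : R -> 'cV[R[i]]_m) : locint u ->
  loc_integrable_vec (fun s => realv (bimx B1 B2 (u s))).
Proof.
move=> /locintP ui; rewrite (funext (fun s => realv_bimx B1 B2 (u s))).
by apply: loc_integrable_vecM => // i j; exact: cst_continuous.
Qed.

Lemma realv_variation_of_constants (u : R -> 'cV[R[i]]_m) t : locint u -> 0 <= t ->
  realv (biexp t A1 A2 x0
         + cint t (fun s => biexp (t - s) A1 A2 (bimx B1 B2 (u s)))) =
  variation_of_constants (realmx A1 A2)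
    (fun s => realv (bimx B1 B2 (u s))) (realv x0) t.
Proof.
move=> ui t0; rewrite variation_of_constantsE//; last exact: loc_integrable_bimx.
rewrite realvD realv_biexp realv_cint; congr (_ + _).
by apply: eq_int0v => s _; rewrite realv_biexp.
Qed.

End Solutions.
Theorem theorem1 (R : realType) (n m : nat)
    (A1 A2 : 'M[R[i]]_n) (B1 B2 : 'M[R[i]]_(n, m)) :
  (* continuous time, t in R^+ *)
  (forall (x0 : 'cV[R[i]]_n) (u : R -> 'cV[R[i]]_m),
     locint u ->
     let X := fun t : R =>
       biexp t A1 A2 x0 + cint t (fun s => biexp (t - s) A1 A2 (bimx B1 B2 (u s))) in
     csol A1 A2 B1 B2 x0 u X /\
     (forall x : R -> 'cV[R[i]]_n, csol A1 A2 B1 B2 x0 u x ->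
        forall t : R, 0 <= t -> x t = X t) /\
     (forall t : R, 0 <= t ->
        X t = bimx (Phi1C A1 A2 t) (Phi2C A1 A2 t) x0
              + cint t (fun s => bimx (Phi1C A1 A2 (t - s)) (Phi2C A1 A2 (t - s))
                                      (bimx B1 B2 (u s))))) /\
  (* discrete time, t in Z^+ *)
  (forall (x0 : 'cV[R[i]]_n) (u : nat -> 'cV[R[i]]_m),
     let X := fun t : nat =>
       bipow A1 A2 t x0
       + \sum_(0 <= i < t) bipow A1 A2 (t - 1 - i)%N (bimx B1 B2 (u i)) in
     dsol A1 A2 B1 B2 x0 u X /\
     (forall x : nat -> 'cV[R[i]]_n, dsol A1 A2 B1 B2 x0 u x ->
        forall t : nat, (1 <= t)%N -> x t = X t) /\
     (forall t : nat, (1 <= t)%N ->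
        X t = bimx (Phi1D A1 A2 t) (Phi2D A1 A2 t) x0
              + \sum_(0 <= i < t)
                  bimx (Phi1D A1 A2 (t - 1 - i)%N) (Phi2D A1 A2 (t - 1 - i)%N)
                       (bimx B1 B2 (u i)))).
Proof.
split=> [x0 u ui X|x0 u X]; last first.
  have Xsol : dsol A1 A2 B1 B2 x0 u X by exact: dsol_variation_of_constants.
  split=> //; split=> [x xsol t _|t _]; first exact: dsol_unique xsol Xsol t.
  rewrite /X bimx_PhiD; congr (_ + _).
  by apply: eq_bigr => i _; rewrite bimx_PhiD.
have gi := loc_integrable_bimx B1 B2 ui.
have XE t : 0 <= t -> realv (X t) = variation_of_constants (realmx A1 A2)
    (fun s => realv (bimx B1 B2 (u s))) (realv x0) t.
  exact: realv_variation_of_constants.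
split; last split.
- apply/csolP; apply: eq_rsol (rsol_variation_of_constants _ _ gi) => t t0.
  by rewrite XE.
- move=> x /csolP xsol t t0; apply: (can_inj (@realvK _ _)).
  by rewrite XE// (rsol_unique xsol).
- move=> t t0; rewrite /X bimx_PhiC; congr (_ + cint t _).
  by apply/funext => s; rewrite bimx_PhiC.
Qed.
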